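(* If the capacity ratio $B\ge2$ and the column sparsity $d$ are known in advance, there is an online algorithm for submodular maximization subject to linear packing constraints that is $\Omega\!\left(\alpha d^{-\frac{1}{B-1}}\right)$-competitive: namely, Algorithm 3 modified to reject the first $pn$ items (sampling phase), with $p=1-\frac{1}{2e}\left(\frac{1}{2d}\right)^{\frac{1}{B-1}}$, and to behave like Algorithm 3 in rounds $\ell>pn$; there is an absolute constant $c_0>0$ such that its integral output $y$ satisfies $Ay\le b$ and $\mathbb{E}[F(y)]\ge(c_0\alpha d^{-\frac{1}{B-1}}-o(1))F^*$.
   Context: Linear packing setting. $U$ is a set of $n$ items; $A=(a_{i,j})\in\mathbb{R}_{\ge0}^{m\times U}$ and $b\in\mathbb{R}_{>0}^m$; w.l.o.g. $\max_j a_{i,j}\le1$ for each $i$. The capacity ratio is $B=\min_{i\in[m]} b_i/\max_{j} a_{i,j}$, and the column sparsity $d$ is the maximum number of nonzero entries in a column of $A$. $f\colon 2^U\to\mathbb{R}_{\ge0}$ is monotone submodular with multilinear extension $F(x)=\sum_{R\subseteq U}f(R)\prod_{i\in R}x_i\prod_{i\in U\setminus R}(1-x_i)$, $x\in[0,1]^U$, and $F^*=\sup\{F(x):x\in[0,1]^U,Ax\le b\}$. Items arrive one per round in uniformly random order; the column of item $j$ is revealed on arrival and the algorithm must immediately and irrevocably set $y_j\in\{0,1\}$, keeping $Ay\le b$. For $S\subseteq U$, $\mathcal{P}(\frac{\ell}{n},S)=\{x\in[0,1]^U: Ax\le\frac{\ell}{n}b,\ x_i=0\ \forall i\notin S\}$;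 the algorithm has access to an oracle $\mathcal{A}_F$ returning, for each such polytope $P$, a point $\mathcal{A}_F(P)\in P$ with $F(\mathcal{A}_F(P))\ge\alpha\sup_{x\in P}F(x)$, $\alpha\in(0,1]$. Algorithm 3: start with $x=0$, $S=\emptyset$; in round $\ell$, when item $j$ arrives, set $S:=S\cup\{j\}$, compute $\tilde x^{(\ell)}=\mathcal{A}_F(\mathcal{P}(\frac{\ell}{n},S))$, let $\hat x^{(\ell)}$ be $e_j$ with probability $\tilde x^{(\ell)}_j$ and $0$ otherwise; if $A(x+\hat x^{(\ell)})\le b$ set $x:=x+\hat x^{(\ell)}$; output $y=x$. *)

(* Defs.v *)
From Stdlib Require Import Reals.
From mathcomp Require Import all_boot all_fingroup.
Set Implicit Arguments. Unset Strict Implicit. Unset Printing Implicit Defensive.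
Local Open Scope R_scope.

Definition isz (x : R) : bool := if Req_EM_T x 0 then true else false.
Definition Rleb (x y : R) : bool := if Rle_dec x y then true else false.
Definition Rltb (x y : R) : bool := if Rlt_dec x y then true else false.

Section Packing.
Variables (n m : nat) (A : 'I_m -> 'I_n -> R) (b : 'I_m -> R).

Definition col_nnz (j : 'I_n) : nat := #|[set i : 'I_m | ~~ isz (A i j)]|.
Definition col_sparsity : nat := \max_(j : 'I_n) col_nnz j.

(* B = min_i b_i / max_j a_{i,j} (rows with max_j a_{i,j} = 0 impose no
   constraint, i.e. contribute +oo to the minimum) *)
Definition is_capacity_ratio (B : R) : Prop :=
  (forall i j, A i j * B <= b i) /\
  (exists i j, 0 < A i j /\ A i j * B = b i).

Definition in_P (s : R) (S : {set 'I_n}) (x : 'I_n -> R) : Prop :=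
  (forall j, 0 <= x j <= 1) /\
  (forall i, \big[Rplus/0]_(j : 'I_n) (A i j * x j) <= s * b i) /\
  (forall j, j \notin S -> x j = 0).

Definition int_feasible (Y : {set 'I_n}) : Prop :=
  forall i, \big[Rplus/0]_(j in Y) A i j <= b i.
Definition int_feasibleb (Y : {set 'I_n}) : bool :=
  [forall i, Rleb (\big[Rplus/0]_(j in Y) A i j) (b i)].

Variable f : {set 'I_n} -> R.

Definition monotone : Prop := forall S T : {set 'I_n}, S \subset T -> f S <= f T.
Definition submodular : Prop :=
  forall S T : {set 'I_n}, f (S :|: T) + f (S :&: T) <= f S + f T.

Definition multilinear (x : 'I_n -> R) : R :=
  \big[Rplus/0]_(T : {set 'I_n})
     (f T * \big[Rmult/1]_(j : 'I_n) (if j \in T then x j else 1 - x j)).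

Definition indicator (Y : {set 'I_n}) (j : 'I_n) : R := if j \in Y then 1 else 0.

Definition is_Fstar (v : R) : Prop :=
  is_lub (fun w => exists x, in_P 1 setT x /\ w = multilinear x) v.

Definition oracle_spec (alpha : R) (O : nat -> {set 'I_n} -> 'I_n -> R) : Prop :=
  forall (l : nat) (S : {set 'I_n}), (1 <= l <= n)%N ->
    in_P (INR l / INR n) S (O l S) /\
    forall v, is_lub (fun w => exists x, in_P (INR l / INR n) S x /\ w = multilinear x) v ->
      alpha * v <= multilinear (O l S).

(* Modified Algorithm 3 with sampling parameter p.
   sigma : the arrival order; round r+1 (r : 'I_n) sees item sigma r.
   c : the outcomes of the per-round coins (coin of round r+1 is true with
   probability q r = xtilde^{(r+1)}_{sigma r} in a non-sampling round, and
   is irrelevant -- probability 0 -- in a sampling round). *)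
Variables (O : nat -> {set 'I_n} -> 'I_n -> R) (p : R) (sigma : {perm 'I_n}).

Definition seen (r : 'I_n) : {set 'I_n} := sigma @: [set t : 'I_n | (t <= r)%N].

Definition active (r : 'I_n) : bool := Rltb (p * INR n) (INR r.+1).

Definition coin_prob (r : 'I_n) : R :=
  if active r then O r.+1 (seen r) (sigma r) else 0.

Variable c : {ffun 'I_n -> bool}.

Definition step (r : 'I_n) (Y : {set 'I_n}) : {set 'I_n} :=
  if active r && c r && int_feasibleb (sigma r |: Y) then sigma r |: Y else Y.

Fixpoint run (k : nat) : {set 'I_n} :=
  match k with
  | 0 => set0
  | k'.+1 => let Y := run k' in
             match (insub k' : option 'I_n) with
             | Some r => step r Y
             | None => Y
             end
  end.

Definition output : {set 'I_n} := run n.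

End Packing.

Definition coin_weight n (O : nat -> {set 'I_n} -> 'I_n -> R) (p : R)
    (sigma : {perm 'I_n}) (c : {ffun 'I_n -> bool}) : R :=
  \big[Rmult/1]_(r : 'I_n) (if c r then coin_prob O p sigma r else 1 - coin_prob O p sigma r).

Definition expected_value n m (A : 'I_m -> 'I_n -> R) (b : 'I_m -> R)
    (f : {set 'I_n} -> R) (O : nat -> {set 'I_n} -> 'I_n -> R) (p : R) : R :=
  (\big[Rplus/0]_(sigma : {perm 'I_n}) \big[Rplus/0]_(c : {ffun 'I_n -> bool})
     (coin_weight O p sigma c *
      multilinear f (indicator (output A b p sigma c)))) / INR (n`!)%N.

Definition p_sample (d : nat) (B : R) : R :=
  1 - / (2 * exp 1) * Rpower (/ (2 * INR d)) (/ (B - 1)).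

(* Main.v *)
Require Import Defs.
From Stdlib Require Import Reals Lra.
From mathcomp Require Import all_boot all_order all_algebra all_fingroup.
From mathcomp Require Import Rstruct.
Set Implicit Arguments. Unset Strict Implicit. Unset Printing Implicit Defensive.

(** Let [T_k] be the set of items tentatively chosen
    (coin equal to 1) in rounds [>= k].  The arrival order is exposed backwards:
    given the set [S_k] seen up to round [k] and everything that happens after
    round [k], the [k]-th item is uniform in [S_k].

    Telescoping the value of the output from the last round to the first, and
    comparing each marginal with the one over the larger set [T_{k+1}], the
    output is worth at least the sum over accepted [k] of
    [f T_k - f T_{k+1}], a quantity determined by rounds [>= k].  Whether the
    item of round [k] fits is decided by rounds [< k]; backwards exposure gives an
    exponential moment bound for the load of these rounds on a row, and a union
    bound over the at most [d] rows used by the item shows that it is rejected with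
    conditional probability at most [1/2].  So the output keeps half of the value
    of all tentative items.

    Uniformity of the [k]-th item yields
    [E f T_k >= (1 - 1/k) E f T_{k+1} + (1/k) E F(xtilde_k)], and
    [E F(xtilde_k) >= alpha (k/n)^2 F(x)] for every feasible [x], since
    [(k/n) x] restricted to [S_k] is admissible for the oracle.  Hence
    [E f T_k / (k - 1)] exceeds [E f T_{k+1} / k] by at least
    [alpha F(x) / n^2] in each of the at least [(1 - p) n] active rounds. *)

(** * Real constants *)

Section RealFacts.
Local Open Scope R_scope.

(** Convexity: the tangent of [exp] at [t * z], evaluated at [0] and at [t], is averaged with
    weights [1 - z] and [z]. *)
Lemma exp_chord (t z : R) : 0 <= z <= 1 -> exp (t * z) <= 1 + (exp t - 1) * z.
Proof.
move=> z01.
have h1 := exp_ineq1_le (- (t * z)).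
have h2 := exp_ineq1_le (t - t * z).
have e1 : exp (t * z) * exp (- (t * z)) = 1.
  by rewrite -exp_plus Rplus_opp_r exp_0.
have e2 : exp (t * z) * exp (t - t * z) = exp t.
  by rewrite -exp_plus; f_equal; ring.
have u0 := exp_pos (t * z).
have p1 : 0 <= (1 - z) * exp (t * z) * (exp (- (t * z)) - (1 + - (t * z))).
  by apply: Rmult_le_pos; [apply: Rmult_le_pos|]; lra.
have p2 : 0 <= z * exp (t * z) * (exp (t - t * z) - (1 + (t - t * z))).
  by apply: Rmult_le_pos; [apply: Rmult_le_pos|]; lra.
nra.
Qed.

Lemma ln_mono (x y : R) : 0 < x -> x <= y -> ln x <= ln y.
Proof. by move=> x0 [/(ln_increasing _ _ x0)|->]; lra. Qed.

Lemma exp1_ge2 : 2 <= exp 1.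
Proof. have := exp_ineq1_le 1; lra. Qed.

Variables (d B : R).
Hypotheses (d1 : 1 <= d) (B2 : 2 <= B).

(** The fraction [1 - p] of rounds outside the sampling phase. *)
Definition delta : R := / (2 * exp 1) * Rpower (/ (2 * d)) (/ (B - 1)).

Lemma delta_exp : delta = / 2 * exp (- 1 - ln (2 * d) / (B - 1)).
Proof.
rewrite /delta /Rpower Rinv_mult -exp_Ropp ln_Rinv; last lra.
rewrite Rmult_assoc -exp_plus; do 2 f_equal; field; lra.
Qed.

Lemma ln2d_ge0 : 0 <= ln (2 * d).
Proof. rewrite -ln_1; apply: ln_mono; lra. Qed.

Lemma delta_bounds : 0 < delta <= / 4.
Proof.
have e := exp1_ge2; rewrite delta_exp; split.
  by have := exp_pos (- 1 - ln (2 * d) / (B - 1)); lra.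
have h : exp (- 1 - ln (2 * d) / (B - 1)) <= exp (- 1).
  have := ln2d_ge0 => l0.
  have q : 0 <= ln (2 * d) / (B - 1) 
    by apply: Rmult_le_pos => //; left; apply: Rinv_0_lt_compat; lra.
  case: q => [q|<-]; last by rewrite Rminus_0_r; lra.
  left; apply: exp_increasing; lra.
have h2 : exp (- 1) <= / 2.
  have -> : - 1 = Ropp 1 by lra.
  by rewrite exp_Ropp; apply: Rinv_le_contravar; lra.
lra.
Qed.

(** The exponent of the moment bound. It equals [1 + ln (2 * d) / (B - 1)], and [exp lam] cancels
    the factor [delta] in the number of active rounds. *)
Definition lam : R := - ln (2 * delta).

Lemma exp_lam : exp lam = / (2 * delta).
Proof. by rewrite /lam exp_Ropp exp_ln //; have := delta_bounds; lra. Qed.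

Lemma lam_ge0 : 0 <= lam.
Proof.
have := delta_bounds => h; rewrite /lam.
have : ln (2 * delta) <= ln 1 by apply: ln_mono; lra.
rewrite ln_1; lra.
Qed.

(** Since [lam * (B - 1) = (B - 1) + ln (2 * d)], each of the [d] rows contributes [/ (2 * d)]. *)
Lemma union_bound_constant : d * (exp (- (lam * (B - 1))) * exp (B - 1)) = / 2.
Proof.
rewrite Ropp_mult_distr_l -exp_plus /lam delta_exp -Rmult_assoc Rinv_r ?Rmult_1_l ?ln_exp; last lra.
have -> : - - (-1 - ln (2 * d) / (B - 1)) * (B - 1) + (B - 1) = - ln (2 * d) by field; lra.
rewrite exp_Ropp exp_ln; [field; lra | lra].
Qed.

(** As [/ (B - 1) <= 1], the factor 2 inside the power costs at most [/ 2]. *)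
Lemma delta_lower : / (4 * exp 1) * Rpower d (- / (B - 1)) <= delta.
Proof.
rewrite /delta /Rpower ln_Rinv ?ln_mult; [|lra..].
have -> : / (B - 1) * - (ln 2 + ln d) = - (/ (B - 1) * ln 2) + - / (B - 1) * ln d by ring.
rewrite exp_plus.
have h : / 2 <= exp (- (/ (B - 1) * ln 2)).
  rewrite -{1}(exp_ln 2); last lra.
  rewrite -exp_Ropp.
  have l2 : 0 < ln 2 by rewrite -ln_1; apply: ln_increasing; lra.
  have i1 : / (B - 1) <= 1 by rewrite -Rinv_1; apply: Rinv_le_contravar; lra.
  have : - ln 2 <= - (/ (B - 1) * ln 2) by nra.
  by case=> [/exp_increasing|->]; lra.
have e := exp1_ge2.
have -> : / (4 * exp 1) = / (2 * exp 1) * / 2 by field; lra.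
rewrite -!Rmult_assoc; apply: Rmult_le_compat_r; first by left; apply: exp_pos.
by apply: Rmult_le_compat_l => //; left; apply: Rinv_0_lt_compat; lra.
Qed.

Lemma mgf_power_bound (n k : nat) : (0 < n)%coq_nat -> INR k <= delta * INR n ->
  (1 + (exp lam - 1) * (B / INR n)) ^ k <= exp (B - 1).
Proof.
move=> n0 kn; have dl := delta_bounds.
have n0' : 0 < INR n by apply: lt_0_INR.
have th0 : 0 <= exp lam - 1 by have := exp_ineq1_le lam; have := lam_ge0; lra.
have Bn : 0 <= B / INR n by apply: Rmult_le_pos; [lra | left; apply: Rinv_0_lt_compat].
have x0 : 0 <= (exp lam - 1) * (B / INR n) by apply: Rmult_le_pos.
set x := (exp lam - 1) * (B / INR n) in x0 *.
apply: (Rle_trans _ (exp (x * INR k))).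
  rewrite -Rpower_pow; last lra.
  rewrite /Rpower.
  have : INR k * ln (1 + x) <= x * INR k.
    have : ln (1 + x) <= x by rewrite -{2}(ln_exp x); apply: ln_mono; [lra | apply: exp_ineq1_le].
    by have := pos_INR k; nra.
  by case=> [/exp_increasing|->]; lra.
(* The exponent is at most [B / 2], which is at most [B - 1] because [B >= 2]. *)
have : x * INR k <= B - 1.
  have -> : x * INR k = (exp lam - 1) * (B / INR n) * INR k by [].
  apply: (Rle_trans _ (exp lam * (B / INR n) * (delta * INR n))).
    apply: Rmult_le_compat => //; first exact: pos_INR.
    by apply: Rmult_le_compat_r => //; lra.
  rewrite exp_lam.
  have -> : / (2 * delta) * (B / INR n) * (delta * INR n) = B / 2 by field; lra.
  lra.
by case=> [/exp_increasing|->]; lra.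
Qed.

Lemma competitive_ratio_le (alpha eps F E : R) : 0 < alpha -> 0 < eps -> 0 <= F ->
  alpha * (delta / 4) * F <= E ->
  (/ (16 * exp 1) * alpha * Rpower d (- / (B - 1)) - eps) * F <= E.
Proof.
move=> a0 e0 F0; apply: Rle_trans; apply: Rmult_le_compat_r => //.
have e2 := exp1_ge2.
have -> : / (16 * exp 1) * alpha * Rpower d (- / (B - 1)) =
    alpha * (/ (4 * exp 1) * Rpower d (- / (B - 1)) / 4) by field; lra.
have := Rmult_le_compat_l alpha _ _ (Rlt_le _ _ a0) delta_lower; lra.
Qed.

End RealFacts.

From mathcomp Require Import ring lra zify.
Import Order.TTheory GRing.Theory Num.Theory.
Local Open Scope ring_scope.

(** * Multilinear extensions *)

Section Multilinear.
Variables (K : realFieldType) (T : finType).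
Implicit Types (f g : {set T} -> K) (x y : T -> K).

Definition pw x (S : {set T}) : K := \prod_j (if j \in S then x j else 1 - x j).
Definition mlin f x : K := \sum_(S : {set T}) f S * pw x S.

Lemma eq_mlin f g x y : f =1 g -> x =1 y -> mlin f x = mlin g y.
Proof.
move=> fg xy; apply: eq_bigr => S _; rewrite fg; congr (_ * _).
by apply: eq_bigr => j _; rewrite xy.
Qed.

Lemma mlinD f g x : mlin (fun S => f S + g S) x = mlin f x + mlin g x.
Proof. by rewrite /mlin -big_split; apply: eq_bigr => S _; rewrite mulrDl. Qed.

Lemma mlinZ c f x : mlin (fun S => c * f S) x = c * mlin f x.
Proof. by rewrite /mlin mulr_sumr; apply: eq_bigr => S _; rewrite mulrA. Qed.

Lemma mlin_sum (I : finType) (P : pred I) (F : I -> {set T} -> K) x :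
  mlin (fun S => \sum_(i | P i) F i S) x = \sum_(i | P i) mlin (F i) x.
Proof.
by rewrite /mlin exchange_big; apply: eq_bigr => S _; rewrite mulr_suml.
Qed.

Lemma mlin_cst c x : mlin (fun=> c) x = c.
Proof.
rewrite /mlin -mulr_sumr (_ : \sum_S _ = \prod_j (x j + (1 - x j))).
  by rewrite big1 ?mulr1 // => j _; ring.
by rewrite bigA_distr.
Qed.

(** Each set without [j] is grouped with its union with [j], which isolates the dependence on
    coordinate [j]. *)
Lemma mlin_pair j f x :
  mlin f x = \sum_(S : {set T} | j \notin S)
    (x j * f (j |: S) + (1 - x j) * f S) *
    \prod_(i | i != j) (if i \in S then x i else 1 - x i).
Proof.
rewrite /mlin (bigID (fun S : {set T} => j \in S)) /=.
rewrite (reindex_onto (fun S => j |: S) (fun S => S :\ j)) /=; last first.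
  by move=> S jS; rewrite setD1K.
rewrite (eq_bigl (fun S : {set T} => j \notin S)); last first.
  move=> S; rewrite setU11 /=; apply/eqP/idP => [<-|jS]; first by rewrite setD11.
  by rewrite setU1K.
rewrite -big_split; apply: eq_bigr => S jS /=.
rewrite mulrDl /pw; congr (_ + _).
  rewrite (bigD1 j) //= setU11 mulrA [f _ * _]mulrC; congr (_ * _).
  by apply: eq_bigr => i ij; rewrite in_setU1 (negPf ij).
by rewrite (bigD1 j) //= (negPf jS) mulrA [f _ * _]mulrC.
Qed.

Lemma mlin_split j f x : mlin f x =
  x j * mlin (fun S => f (j |: S)) x + (1 - x j) * mlin (fun S => f (S :\ j)) x.
Proof.
rewrite !(mlin_pair j) !mulr_sumr -big_split; apply: eq_bigr => S jS /=.
rewrite setUA setUid setU1K // (setDidPl _); first by ring.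
by rewrite disjoint_sym disjoints1.
Qed.

Lemma mlin_upd j f x y : (forall S : {set T}, j \notin S -> f (j |: S) = f S) ->
  (forall i, i != j -> x i = y i) -> mlin f x = mlin f y.
Proof.
move=> fj xy; rewrite !(mlin_pair j); apply: eq_bigr => S jS.
rewrite fj //; congr (_ * _); first by ring.
by apply: eq_bigr => i ij; rewrite xy.
Qed.

Lemma mlin_dep (D : pred T) f x y :
  (forall S S' : {set T}, (forall i, D i -> (i \in S) = (i \in S')) -> f S = f S') ->
  (forall i, D i -> x i = y i) -> mlin f x = mlin f y.
Proof.
(* Hybrid argument: [z s] has already switched to [y] on the coordinates in [s]. *)
move=> fD xy; pose z (s : seq T) i := if i \in s then y i else x i.
have zE (s : seq T) : mlin f x = mlin f (z s).
  elim: s => [|j s ->]; first by apply: eq_mlin.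
  have [Dj|Dj] := boolP (D j).
    apply: eq_mlin => // i; rewrite /z in_cons.
    by case: eqVneq => // ->; rewrite xy //; case: ifP.
  apply: (@mlin_upd j) => [S jS|i ij]; last by rewrite /z in_cons (negPf ij).
  apply: fD => i Di; rewrite in_setU1.
  by case: eqVneq => // ij; rewrite -ij Di in Dj.
rewrite (zE (enum T)); apply: eq_mlin => // i.
by rewrite /z mem_enum.
Qed.

Lemma pw_ge0 x S : (forall j, 0 <= x j <= 1) -> 0 <= pw x S.
Proof.
move=> x01; apply: prodr_ge0 => j _.
by have /andP[x0 x1] := x01 j; case: ifP; rewrite ?subr_ge0.
Qed.

Lemma mlin_le f g x : (forall j, 0 <= x j <= 1) -> (forall S, f S <= g S) ->
  mlin f x <= mlin g x.
Proof.
move=> x01 fg; apply: ler_sum => S _; apply: ler_wpM2r; last exact: fg.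
exact: pw_ge0.
Qed.

Lemma mlin_mem j x : mlin (fun S => (j \in S)%:R) x = x j.
Proof.
rewrite (mlin_split j) (@eq_mlin _ (fun=> 1) x x) // => [|S]; last by rewrite setU11.
rewrite (@eq_mlin (fun S => (j \in S :\ j)%:R) (fun=> 0) x x) // => [|S].
  by rewrite !mlin_cst mulr1 mulr0 addr0.
by rewrite setD11.
Qed.

Lemma mlin_mono f x y : (forall S S' : {set T}, S \subset S' -> f S <= f S') ->
  (forall j, 0 <= x j) -> (forall j, y j <= 1) -> (forall j, x j <= y j) ->
  mlin f x <= mlin f y.
Proof.
move=> fm x0 y1 xy; pose z (s : seq T) i := if i \in s then y i else x i.
have z01 (s : seq T) i : 0 <= z s i <= 1.
  rewrite /z; case: ifP => _; rewrite ?y1 ?x0 ?andbT /=.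
    exact: le_trans (x0 i) (xy i).
  exact: le_trans (xy i) (y1 i).
have zE (s : seq T) : mlin f x <= mlin f (z s).
  elim: s => [|j s IH]; first by rewrite le_eqVlt; apply/orP; left; apply/eqP; apply: eq_mlin.
  apply: (le_trans IH); rewrite !(mlin_pair j); apply: ler_sum => S jS.
  rewrite (eq_bigr (fun i => if i \in S then z (j :: s) i else 1 - z (j :: s) i)).
    apply: ler_wpM2r.
      apply: prodr_ge0 => i _.
      by have /andP[? ?] := z01 (j :: s) i; case: ifP; rewrite ?subr_ge0.
    have fS := fm S (j |: S) (subsetUr _ _).
    have zj : z s j <= z (j :: s) j.
      by rewrite /z mem_head; case: ifP.
    rewrite -subr_ge0 [X in 0 <= X](_ : _ = (z (j :: s) j - z s j) * (f (j |: S) - f S)).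
      by rewrite mulr_ge0 // subr_ge0.
    by ring.
  by move=> i ij; rewrite /z in_cons (negPf ij).
apply: (le_trans (zE (enum T))); rewrite le_eqVlt; apply/orP; left; apply/eqP.
by apply: eq_mlin => // i; rewrite /z mem_enum.
Qed.

Lemma mlin_indicator f (Y : {set T}) : mlin f (fun j => if j \in Y then 1 else 0) = f Y.
Proof.
rewrite /mlin (bigD1 Y) //= big1 ?addr0 => [|S SY].
  by rewrite /pw big1 ?mulr1 // => j _; case: (j \in Y); rewrite ?subr0.
have /existsP[j jSY] : [exists j, (j \in S) != (j \in Y)].
  rewrite -negb_forall; apply: contra SY => /forallP h.
  by apply/eqP/setP => j; apply/eqP.
rewrite /pw (bigD1 j) //=.
by case: (j \in S) (j \in Y) jSY => [] []; rewrite //= ?subrr !(mul0r, mulr0).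
Qed.

Lemma mlin0 f : mlin f (fun=> 0) = f set0.
Proof.
rewrite -mlin_indicator; apply: eq_mlin => // j.
by rewrite in_set0.
Qed.

End Multilinear.

(** * Monotone submodular functions and their multilinear extensions *)

Section Submodular.
Variables (K : realFieldType) (T : finType) (f : {set T} -> K).
Hypothesis fm : forall S S' : {set T}, S \subset S' -> f S <= f S'.
Hypothesis fs : forall S S' : {set T}, f (S :|: S') + f (S :&: S') <= f S + f S'.

(** Submodularity applied to [j |: S] and [S']; if [j] lies in [S'], the left side is zero and
    monotonicity suffices. *)
Lemma marginal_le j (S S' : {set T}) : S \subset S' ->
  f (j |: S') - f S' <= f (j |: S) - f S.
Proof.
move=> SS'; have [jS'|jS'] := boolP (j \in S').
  rewrite [j |: S'](setUidPr _) ?sub1set // subrr subr_ge0.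
  exact/fm/subsetUr.
have := fs (j |: S) S'.
rewrite -setUA (setUidPr SS') setIUl (setIidPl SS').
rewrite (_ : [set j] :&: S' = set0) ?set0U; last first.
  by apply: disjoint_setI0; rewrite disjoints1.
lra.
Qed.

Lemma setU_marginals (S S' : {set T}) :
  f (S :|: S') <= f S' + \sum_(j in S) (f (j |: S') - f S').
Proof.
elim: {S}_.+1 {-2}S (ltnSn #|S|) => // k IH S Sk.
have [->|[j jS]] := set_0Vmem S; first by rewrite set0U big_set0 addr0.
rewrite (big_setD1 j) //= -{1}(setD1K jS) -setUA.
have cS : (#|S :\ j| < k)%N by move: Sk; rewrite (cardsD1 j S) jS.
have := marginal_le j (subsetUr (S :\ j) S').
have := IH _ cS; lra.
Qed.

(** By [setU_marginals], [f] is below a function linear in the membership indicators, whose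
    expectations are the [x j]. *)
Lemma mlin_gain x (S' : {set T}) : (forall j, 0 <= x j <= 1) ->
  mlin f x <= f S' + \sum_j x j * (f (j |: S') - f S').
Proof.
move=> x01; apply: (@le_trans _ _ (mlin (fun S => f S' +
    \sum_j (f (j |: S') - f S') * (j \in S)%:R) x)).
  apply: mlin_le => // S; apply: (le_trans (fm (subsetUl S S'))).
  apply: (le_trans (setU_marginals _ _)); rewrite lerD2l big_mkcond.
  by apply: ler_sum => j _; case: (j \in S); rewrite ?mulr1 ?mulr0.
rewrite mlinD mlin_cst mlin_sum; rewrite lerD2l; apply: ler_sum => j _.
by rewrite mlinZ mlin_mem mulrC.
Qed.

Definition restr (s : seq T) (x : T -> K) i : K := if i \in s then x i else 0.

(** The partial derivative of [mlin f] in direction [j]; the integrand does not depend on whether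
    [S] contains [j]. *)
Definition slope j x := mlin (fun S => f (j |: S) - f (S :\ j)) x.

Lemma mlin_restr_cons j s x : j \notin s ->
  mlin f (restr (j :: s) x) = mlin f (restr s x) + x j * slope j (restr s x).
Proof.
move=> js.
have E (g : {set T} -> K) : (forall S : {set T}, j \notin S -> g (j |: S) = g S) ->
    mlin g (restr (j :: s) x) = mlin g (restr s x).
  by move=> gj; apply: (@mlin_upd _ _ j) => // i ij; rewrite /restr in_cons (negPf ij).
have Esl : slope j (restr s x) =
    mlin (fun S => f (j |: S)) (restr s x) - mlin (fun S => f (S :\ j)) (restr s x).
  by rewrite -mulN1r -mlinZ -mlinD; apply: eq_mlin => // S; rewrite mulN1r.
have E1 : mlin (fun S => f (j |: S)) (restr (j :: s) x) = mlin (fun S => f (j |: S)) (restr s x).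
  by apply: E => S jS; rewrite setUA setUid.
have E2 : mlin (fun S => f (S :\ j)) (restr (j :: s) x) = mlin (fun S => f (S :\ j)) (restr s x).
  by apply: E => S jS; rewrite setU1K // (setDidPl _) // disjoint_sym disjoints1.
have := mlin_split j f (restr (j :: s) x).
have := mlin_split j f (restr s x).
have -> : restr (j :: s) x j = x j by rewrite /restr mem_head.
have -> : restr s x j = 0 by rewrite /restr (negPf js).
rewrite E1 E2 Esl => -> ->.
move: (mlin _ (restr s x)) (mlin _ (restr s x)) => u v; ring.
Qed.

(** Marginals shrink as the set grows, so the negated integrand is monotone. *)
Lemma slope_anti j x y : (forall i, 0 <= y i <= x i) -> (forall i, x i <= 1) ->
  slope j x <= slope j y.
Proof.
move=> yx x1; rewrite -lerN2.
have negE z : - slope j z = mlin (fun S => f (S :\ j) - f (j |: S)) z.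
  by rewrite -mulN1r -mlinZ; apply: eq_mlin => // S; rewrite mulN1r opprB.
rewrite !negE; apply: mlin_mono.
- move=> S S' SS'; rewrite -opprB -[X in _ <= X]opprB lerN2.
  have e (X : {set T}) : j |: X = j |: (X :\ j).
    by apply/setP => i; rewrite !inE; case: eqP.
  by rewrite (e S) (e S'); apply: marginal_le; apply: setSD.
- by move=> i; have /andP[] := yx i.
- by [].
- by move=> i; have /andP[] := yx i.
Qed.

(* [D j] is the slope of [mlin f] in direction [j] at the point obtained from
   [x] by zeroing the coordinates after [j] in the enumeration of [T]. *)
Lemma mlin_minorant x : (forall j, 0 <= x j <= 1) -> exists D : T -> K,
  mlin f x = f set0 + \sum_j x j * D j /\
  forall y, (forall j, 0 <= y j <= x j) -> f set0 + \sum_j y j * D j <= mlin f y.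
Proof.
move=> x01.
suff /(_ (enum T) (enum_uniq T)) [D [D1 D2]] : forall s : seq T, uniq s ->
    exists D : T -> K, mlin f (restr s x) = f set0 + \sum_(j <- s) x j * D j /\
    forall y, (forall j, 0 <= y j <= x j) ->
    f set0 + \sum_(j <- s) y j * D j <= mlin f (restr s y).
  have rE z : mlin f (restr (enum T) z) = mlin f z.
    by apply: eq_mlin => // i; rewrite /restr mem_enum.
  exists D; rewrite -rE D1 big_enum; split=> // y yx.
  by have := D2 y yx; rewrite rE big_enum.
elim=> [_|j s IH /= /andP[js us]].
  have r0 y : mlin f (restr [::] y) = f set0.
    by rewrite -[RHS]mlin0; apply: eq_mlin.
  by exists (fun=> 0); split=> [|y _]; rewrite big_nil addr0 r0.
have [D [D1 D2]] := IH us.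
(* [s] is the part of the list behind [j], so only the coordinates behind [j] are switched on here.
   By [slope_anti] the slope at a smaller [y] is no less. *)
exists (fun i => if i == j then slope j (restr s x) else D i).
have bE z : \sum_(i <- s) z i * (if i == j then slope j (restr s x) else D i) =
    \sum_(i <- s) z i * D i.
  rewrite !big_seq; apply: eq_bigr => i si.
  by case: eqVneq => // ij; rewrite -ij si in js.
split=> [|y yx]; rewrite big_cons eqxx bE mlin_restr_cons //.
  by rewrite D1 -addrA; congr (_ + _); exact: addrC.
have sxy : slope j (restr s x) <= slope j (restr s y).
  apply: slope_anti => i; rewrite /restr; case: ifP => // _; first by rewrite lexx.
  by have /andP[] := x01 i.
have /andP[yj _] := yx j.
rewrite addrCA addrC; apply: lerD; first exact: D2.
exact: ler_wpM2l.
Qed.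

End Submodular.

(** * Uniform arrival orders *)

Section RandomOrder.
Variables (K : realFieldType) (n : nat).
Implicit Types (s : {perm 'I_n}) (k r t : 'I_n).

Lemma mem_seen s k r : (s r \in seen s k) = (r <= k)%N.
Proof. by rewrite mem_imset ?inE //; apply: perm_inj. Qed.

(** The items seen up to round [k] are those that do not arrive later. *)
Lemma seen_eq s s' k : (forall r, (k < r)%N -> s r = s' r) -> seen s k = seen s' k.
Proof.
move=> ss'; apply/setP => j; rewrite -(permKV s j); move: (s^-1%g j) => r.
rewrite mem_seen -[s r in RHS](permKV s') mem_seen.
case: (leqP r k) => rk; case: (leqP _ k) => // r'k.
  by have := ss' _ r'k; rewrite permKV => /perm_inj e; rewrite e ltnNge rk in r'k.
by rewrite ss' // permK leqNgt rk in r'k.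
Qed.

Lemma sum_seen s k (h : 'I_n -> K) :
  \sum_(j in seen s k) h j = \sum_(t : 'I_n | (t <= k)%N) h (s t).
Proof.
rewrite big_imset /=; last by move=> x y _ _; apply: perm_inj.
by apply: eq_bigl => t; rewrite inE.
Qed.

Lemma card_seen s k : #|seen s k| = k.+1.
Proof.
rewrite card_imset; last exact: perm_inj.
by rewrite cardsE -sum1_card -(big_ord_widen _ (fun=> 1%N) (ltn_ord k)) sum1_card card_ord.
Qed.

(* Swapping the arrival positions [t <= k] and [k] changes neither [seen s k]
   nor later arrivals, hence the [k]-th arrival is uniform in [seen s k]. *)
Lemma sum_perm_avg k (h : {perm 'I_n} -> 'I_n -> K) :
  (forall s s' j, (forall r, (k < r)%N -> s r = s' r) -> h s j = h s' j) ->
  \sum_s h s (s k) = \sum_s k.+1%:R^-1 * \sum_(j in seen s k) h s j.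
Proof.
move=> hk; rewrite -mulr_sumr.
have -> : \sum_s \sum_(j in seen s k) h s j = \sum_s \sum_(t : 'I_n | (t <= k)%N) h s (s t).
  by apply: eq_bigr => s _; exact: sum_seen.
rewrite exchange_big /=.
have -> : \sum_(t : 'I_n | (t <= k)%N) \sum_s h s (s t) =
    \sum_(t : 'I_n | (t <= k)%N) \sum_s h s (s k).
  apply: eq_bigr => t tk.
  rewrite (reindex_inj (mulgI (tperm t k))); apply: eq_bigr => s _.
  rewrite permM tpermL; apply: hk => r kr; rewrite permM tpermD //.
    by rewrite neq_ltn (leq_ltn_trans tk kr).
  by rewrite neq_ltn kr.
have := sum_seen 1%g k (fun=> \sum_s h s (s k)).
rewrite sumr_const card_seen => <-; rewrite -[(\sum_s _) *+ _]mulr_natl mulKf //.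
by rewrite pnatr_eq0.
Qed.

Lemma card_perm_ord : #|{perm 'I_n}| = n`!.
Proof. by rewrite -cardsT -(card_Sn n); apply: eq_card => s; rewrite !inE. Qed.

(** Relabelling items by a transposition shows that the sum is the same for all items; over all
    items together, each order contributes [k.+1]. *)
Lemma sum_perm_seen k j :
  \sum_s ((j \in seen s k)%:R : K) = k.+1%:R / n%:R * n`!%:R.
Proof.
have n0 : (n%:R : K) != 0 by rewrite pnatr_eq0 -lt0n (leq_trans _ (ltn_ord k)).
have E i : \sum_s ((i \in seen s k)%:R : K) = \sum_s ((j \in seen s k)%:R : K).
  rewrite (reindex_inj (mulIg (tperm i j))); apply: eq_bigr => s _; congr (_%:R).
  rewrite -{1}(tpermR i j) -[X in tperm i j X](permKV s) -permM mem_seen.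
  by rewrite -{2}(permKV s j) mem_seen.
have : \sum_i \sum_s ((i \in seen s k)%:R : K) = k.+1%:R * n`!%:R.
  rewrite exchange_big /= (eq_bigr (fun=> k.+1%:R)) => [|s _].
    by rewrite sumr_const -[LHS]mulr_natr card_perm_ord.
  rewrite -natr_sum; congr (_%:R); rewrite -(card_seen s k) -sum1_card [RHS]big_mkcond.
  by apply: eq_bigr => i _; case: ifP.
rewrite (eq_bigr _ (fun i _ => E i)) sumr_const card_ord -[LHS]mulr_natr => h.
by rewrite mulrAC -h mulfK.
Qed.

End RandomOrder.

(** * Expectation over arrival order and coins *)

Section Process.
Variables (K : realFieldType) (n r0 : nat).
Variable xt : 'I_n -> {set 'I_n} -> 'I_n -> K.
Hypothesis xt01 : forall k S j, 0 <= xt k S j <= 1.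
Implicit Types (s : {perm 'I_n}) (C : {set 'I_n}) (Phi : {perm 'I_n} -> {set 'I_n} -> K).

Definition coin s (r : 'I_n) : K := if (r0 <= r)%N then xt r (seen s r) (s r) else 0.

Lemma coin01 s r : 0 <= coin s r <= 1.
Proof. by rewrite /coin; case: ifP => // _; rewrite lexx ler01. Qed.

(* The coins are encoded by the set [C] of rounds (counted from 0) whose coin is
   true, so that averaging over them is a multilinear extension at [coin s]. *)
Definition EE Phi : K := (\sum_s mlin (Phi s) (coin s)) / n`!%:R.

Lemma fact_gt0K : 0 < (n`!%:R : K). Proof. by rewrite ltr0n fact_gt0. Qed.

Lemma EE_le Phi Psi : (forall s C, Phi s C <= Psi s C) -> EE Phi <= EE Psi.
Proof.
move=> le; apply: ler_wpM2r; first by rewrite invr_ge0 ler0n.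
by apply: ler_sum => s _; apply: mlin_le => //; exact: coin01.
Qed.

Lemma eq_EE Phi Psi : (forall s C, Phi s C = Psi s C) -> EE Phi = EE Psi.
Proof.
by move=> e; congr (_ / _); apply: eq_bigr => s _; apply: eq_mlin.
Qed.

Lemma EED Phi Psi : EE (fun s C => Phi s C + Psi s C) = EE Phi + EE Psi.
Proof.
rewrite /EE -mulrDl -big_split; congr (_ / _).
by apply: eq_bigr => s _; rewrite mlinD.
Qed.

Lemma EEZ c Phi : EE (fun s C => c * Phi s C) = c * EE Phi.
Proof.
rewrite /EE mulrA mulr_sumr; congr (_ / _).
by apply: eq_bigr => s _; rewrite mlinZ.
Qed.

Lemma EE_sum (I : finType) (P : pred I) (F : I -> _) :
  EE (fun s C => \sum_(i | P i) F i s C) = \sum_(i | P i) EE (F i).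
Proof.
rewrite /EE -mulr_suml [in RHS]exchange_big; congr (_ / _).
by apply: eq_bigr => s _; rewrite mlin_sum.
Qed.

Lemma EE_perm (h : {perm 'I_n} -> K) : EE (fun s _ => h s) = (\sum_s h s) / n`!%:R.
Proof. by congr (_ / _); apply: eq_bigr => s _; rewrite mlin_cst. Qed.

Lemma EE_cst c : EE (fun _ _ => c) = c.
Proof.
rewrite EE_perm sumr_const card_perm_ord -[c *+ _]mulr_natr mulfK //.
by rewrite gt_eqF ?fact_gt0K.
Qed.

(** Stands in for measurability with respect to the arrivals and coins of rounds [>= k]. *)
Definition future (X : Type) (k : nat) (Phi : {perm 'I_n} -> {set 'I_n} -> X) :=
  forall s s' C C', (forall r : 'I_n, (k <= r)%N -> s r = s' r) ->
    (forall r : 'I_n, (k <= r)%N -> (r \in C) = (r \in C')) -> Phi s C = Phi s' C'.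

(** Backwards exposure of round [k]: given the later rounds, its item is uniform in [seen s k] and
    its coin has bias [xt k (seen s k) j]. Both are explicit arguments of [Psi] so that they can be
    averaged out. *)
Lemma EE_step (k : 'I_n) (Psi : 'I_n -> bool -> _) : (r0 <= k)%N ->
  (forall j b, future k.+1 (Psi j b)) ->
  EE (fun s C => Psi (s k) (k \in C) s C) =
  EE (fun s C => k.+1%:R^-1 * \sum_(j in seen s k)
        (xt k (seen s k) j * Psi j true s C + (1 - xt k (seen s k) j) * Psi j false s C)).
Proof.
move=> r0k fut; congr (_ / _).
pose h s j := xt k (seen s k) j * mlin (Psi j true s) (coin s)
  + (1 - xt k (seen s k) j) * mlin (Psi j false s) (coin s).
transitivity (\sum_s h s (s k)).
  apply: eq_bigr => s _; rewrite (mlin_split k) /h.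
  have -> : coin s k = xt k (seen s k) (s k) by rewrite /coin r0k.
  congr (_ * _ + _ * _); apply: eq_mlin => // C.
    rewrite setU11; apply: fut => // r kr.
    by rewrite in_setU1; case: eqVneq => // e; rewrite e ltnn in kr.
  rewrite setD11; apply: fut => // r kr.
  by rewrite !inE; case: eqVneq => // e; rewrite e ltnn in kr.
rewrite sum_perm_avg => [|s s' j ss'].
  apply: eq_bigr => s _; rewrite mlinZ mlin_sum; congr (_ * _).
  by apply: eq_bigr => j _; rewrite mlinD !mlinZ.
rewrite /h (seen_eq ss').
have E b : mlin (Psi j b s) (coin s) = mlin (Psi j b s') (coin s').
  transitivity (mlin (Psi j b s') (coin s)).
    by apply: eq_mlin => // C; apply: fut.
  apply: (@mlin_dep _ _ (fun r : 'I_n => (k < r)%N)) => [C C' CC'|r kr].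
    exact: fut.
  (* Later coins have equal biases under both orders, since the sets seen agree from round [k]
     on. *)
  rewrite /coin ss' // (seen_eq (s' := s')) // => r' rr'.
  by apply: ss'; apply: ltn_trans rr'.
by rewrite !E.
Qed.

(* The tentative items of rounds [>= k]; coins of rounds before [r0] are almost
   surely false. *)
Definition tent (k : nat) s C : {set 'I_n} := s @: [set r in C | (k <= r)%N].

Lemma tent_future (X : Type) (h : {set 'I_n} -> X) k : future k (fun s C => h (tent k s C)).
Proof.
move=> s s' C C' ss' CC'; congr h; rewrite /tent.
have -> : [set r in C | (k <= r)%N] = [set r in C' | (k <= r)%N].
  by apply/setP => r; rewrite !inE; case: leqP => [/CC' ->|]; rewrite ?andbF.
by apply: eq_in_imset => r; rewrite inE => /andP[_ /ss'].
Qed.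

Lemma tent_step (k : 'I_n) s C : tent k s C =
  if k \in C then s k |: tent k.+1 s C else tent k.+1 s C.
Proof.
have E : [set r in C | (k <= r)%N] =
    if k \in C then k |: [set r in C | (k < r)%N] else [set r in C | (k < r)%N].
  apply/setP => r; have kr : (k <= r)%N = (r == k) || (k < r)%N.
    by rewrite leq_eqVlt -val_eqE eq_sym.
  by case: ifP => kC; rewrite !inE kr; case: eqVneq => [->|]; rewrite ?kC ?andbF.
by rewrite /tent E; case: ifP => // _; rewrite imsetU1.
Qed.

Lemma tent_all s C : tent n s C = set0.
Proof.
apply/setP => j; rewrite in_set0; apply/imsetP => -[r]; rewrite inE.
by rewrite leqNgt ltn_ord andbF.
Qed.

Lemma tentS k s C : tent k.+1 s C \subset tent k s C.
Proof.
apply/subsetP => j /imsetP[r]; rewrite inE => /andP[rC kr] ->.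
by apply: imset_f; rewrite inE rC ltnW.
Qed.

Section Value.
Variable f : {set 'I_n} -> K.
Hypothesis fm : forall S S' : {set 'I_n}, S \subset S' -> f S <= f S'.
Hypothesis fs : forall S S' : {set 'I_n}, f (S :|: S') + f (S :&: S') <= f S + f S'.
Hypothesis xtS : forall k (S : {set 'I_n}) j, j \notin S -> xt k S j = 0.

(** With [T] the later tentative set and [x] the oracle point, [mlin_gain] bounds the sum of the
    marginals weighted by [x] from below by [mlin f x - f T]. Rounds count from 0, so [k.+1] items
    have been seen. *)
Lemma tent_value_step (k : 'I_n) : (r0 <= k)%N ->
  k%:R / k.+1%:R * EE (fun s C => f (tent k.+1 s C)) +
  k.+1%:R^-1 * EE (fun s C => mlin f (xt k (seen s k))) <= EE (fun s C => f (tent k s C)).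
Proof.
move=> r0k.
pose Psi (j : 'I_n) (b : bool) s C :=
  f (if b then j |: tent k.+1 s C else tent k.+1 s C).
have -> : EE (fun s C => f (tent k s C)) = EE (fun s C => Psi (s k) (k \in C) s C).
  by apply: eq_EE => s C; rewrite tent_step /Psi; case: ifP.
rewrite EE_step // => [|j b]; last first.
  by apply: (@tent_future _ (fun T => f (if b then j |: T else T))).
rewrite -!EEZ -EED; apply: EE_le => s C.
set x := xt k (seen s k); set T := tent k.+1 s C.
have k1 : (k.+1%:R : K) != 0 by rewrite pnatr_eq0.
have := mlin_gain fm fs T (fun j => xt01 k (seen s k) j); rewrite -/x.
have -> : \sum_j x j * (f (j |: T) - f T) = \sum_(j in seen s k) x j * (f (j |: T) - f T).
  rewrite [RHS]big_mkcond; apply: eq_bigr => j _; case: ifPn => // /xtS.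
  by rewrite /x => ->; rewrite mul0r.
have -> : \sum_(j in seen s k) (x j * Psi j true s C + (1 - x j) * Psi j false s C) =
   k.+1%:R * f T + \sum_(j in seen s k) x j * (f (j |: T) - f T).
  have -> : k.+1%:R * f T = \sum_(j in seen s k) f T.
    by rewrite sumr_const card_seen mulr_natl.
  rewrite -big_split; apply: eq_bigr => j _; rewrite /Psi /= -/T; ring.
move: (\sum_(j in _) _) => Sm le.
have -> : k.+1%:R^-1 * (k.+1%:R * f T + Sm) = k.+1%:R^-1 * (k%:R * f T + (f T + Sm)).
  by rewrite addrA -{3}[f T]mul1r -mulrDl natr1.
rewrite mulrDr mulrA [_^-1 * k%:R]mulrC lerD2l.
by apply: ler_wpM2l; rewrite ?invr_ge0 ?ler0n.
Qed.

End Value.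

(** Rounds are averaged out from the earliest on: with all rounds after [l] fixed, the factor of
    round [l] has mean at most [1 + th * mu]. [Phi] sees only rounds [>= k] and acts as a weight. *)
Lemma EE_mgf (z : 'I_n -> K) (th mu : K) (k : nat) Phi :
  0 <= th -> (forall j, 0 <= z j) -> (k <= n)%N ->
  (forall s (l : 'I_n), (r0 <= l)%N ->
    l.+1%:R^-1 * \sum_(j in seen s l) xt l (seen s l) j * z j <= mu) ->
  future k Phi -> (forall s C, 0 <= Phi s C) ->
  EE (fun s C => Phi s C *
      \prod_(r < n | (r0 <= r < k)%N) (1 + th * ((r \in C)%:R * z (s r))))
    <= (1 + th * mu) ^+ (k - r0) * EE Phi.
Proof.
move=> th0 z0 kn zmu fut Phi0.
(* The start [r0] of the product is generalized to [l], for an induction on the number [d] of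
   factors. *)
suff H d l : (r0 <= l)%N -> (l + d = k)%N ->
    EE (fun s C => Phi s C *
      \prod_(r < n | (l <= r < k)%N) (1 + th * ((r \in C)%:R * z (s r))))
    <= (1 + th * mu) ^+ d * EE Phi.
  have [r0k|kr0] := leqP r0 k; first by apply: H => //; rewrite subnKC.
  rewrite (eqP (ltnW kr0 : _ - _ == 0)%N) expr0 mul1r; apply: EE_le => s C.
  rewrite big_pred0 ?mulr1 // => r; apply/negP => /andP[h1 h2].
  by move: (leq_ltn_trans h1 h2); rewrite ltnNge ltnW.
elim: d l => [|d IH] l r0l ldk.
  rewrite expr0 mul1r; apply: EE_le => s C.
  rewrite big_pred0 ?mulr1 // => r; move: ldk; rewrite addn0 => <-.
  by apply/negP => /andP[h1]; rewrite ltnNge h1.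
have ln : (l < n)%N by lia.
pose lo := Ordinal ln.
pose rest s C := Phi s C * \prod_(r < n | (l < r < k)%N) (1 + th * ((r \in C)%:R * z (s r))).
have rest0 s C : 0 <= rest s C.
  apply: mulr_ge0 => //; apply: prodr_ge0 => r _.
  by rewrite addr_ge0 // mulr_ge0 // mulr_ge0 // ler0n.
pose Psi (j : 'I_n) (b : bool) s C := rest s C * (1 + th * (b%:R * z j)).
have -> : EE (fun s C => Phi s C *
      \prod_(r < n | (l <= r < k)%N) (1 + th * ((r \in C)%:R * z (s r))))
    = EE (fun s C => Psi (s lo) (lo \in C) s C).
  apply: eq_EE => s C; rewrite /Psi /rest -mulrA; congr (_ * _).
  rewrite (bigD1 lo) /=; last by lia.
  rewrite mulrC; congr (_ * _); apply: eq_bigl => r.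
  by rewrite -(inj_eq val_inj) /=; lia.
rewrite EE_step // => [|j b s s' C C' ss' CC']; last first.
  rewrite /Psi /rest; congr (_ * _ * _).
    by apply: fut => r kr; [apply: ss' | apply: CC']; rewrite /=; lia.
  by apply: eq_bigr => r /andP[lr _]; rewrite ss' // CC'.
apply: (@le_trans _ _ ((1 + th * mu) * EE rest)); last first.
  have mu0 : 0 <= mu.
    apply: le_trans (zmu 1%g lo r0l); rewrite mulr_ge0 ?invr_ge0 ?ler0n //.
    by apply: sumr_ge0 => j _; rewrite mulr_ge0 //; have /andP[] := xt01 lo (seen 1%g lo) j.
  rewrite exprS -mulrA; apply: ler_wpM2l; first by rewrite addr_ge0 // mulr_ge0.
  by apply: IH; lia.
rewrite -EEZ; apply: EE_le => s C; have := zmu s lo r0l.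
set x := xt lo _.
have -> : \sum_(j in seen s lo) (x j * Psi j true s C + (1 - x j) * Psi j false s C) =
   rest s C * (lo.+1%:R + th * \sum_(j in seen s lo) x j * z j).
  have -> : (lo.+1%:R : K) = \sum_(j in seen s lo) 1 by rewrite sumr_const card_seen.
  rewrite mulr_sumr -big_split mulr_sumr; apply: eq_bigr => j _ /=.
  by rewrite /Psi /=; ring.
move=> le; rewrite mulrCA mulrC; apply: ler_wpM2r => //.
rewrite mulrDr mulVf ?pnatr_eq0 // lerD2l mulrCA.
exact: ler_wpM2l.
Qed.

End Process.

Lemma sum_ord_telescope (K : zmodType) (n r0 : nat) (a : nat -> K) : (r0 <= n)%N ->
  \sum_(k < n | (r0 <= k)%N) (a k - a k.+1) = a r0 - a n.
Proof.
move=> r0n; rewrite -(big_mkord (fun k => (r0 <= k)%N) (fun k => a k - a k.+1)).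
rewrite -(big_nat_widenl r0 0 n xpredT) //.
rewrite -[RHS]opprB -(telescope_sumr _ r0n) -sumrN.
by apply: eq_bigr => k _; rewrite opprB.
Qed.

(** * Value of the tentative items and the share that is accepted *)

Section Analysis.
Variables (K : realFieldType) (n r0 : nat).
Variable xt : 'I_n -> {set 'I_n} -> 'I_n -> K.
Hypothesis xt01 : forall k S j, 0 <= xt k S j <= 1.
Hypothesis xtS : forall k (S : {set 'I_n}) j, j \notin S -> xt k S j = 0.
Variable f : {set 'I_n} -> K.
Hypothesis fm : forall S S' : {set 'I_n}, S \subset S' -> f S <= f S'.
Hypothesis fs : forall S S' : {set 'I_n}, f (S :|: S') + f (S :&: S') <= f S + f S'.
Hypothesis f0 : forall S, 0 <= f S.
Implicit Types (s : {perm 'I_n}) (C P : {set 'I_n}).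

(** The affine minorant from [mlin_minorant] is tight at [x], and its expectation involves only the
    probability [k.+1 / n] that an item is seen. The constant term is handled by [f set0 >= 0]. *)
Lemma mlin_sampled (k : 'I_n) (c : K) (x : 'I_n -> K) :
  0 <= c <= 1 -> (forall j, 0 <= x j <= 1) ->
  c * (k.+1%:R / n%:R) * mlin f x <=
  (\sum_s mlin f (fun j => if j \in seen s k then c * x j else 0)) / n`!%:R.
Proof.
move=> /andP[c0 c1] x01; have [D [D1 D2]] := mlin_minorant fm fs x01.
have nf := fact_gt0K K n.
rewrite ler_pdivlMr //.
apply: (@le_trans _ _ (\sum_s (f set0 +
    \sum_j (c * x j * D j) * (j \in seen s k)%:R))); last first.
  apply: ler_sum => s _.
  pose y j := if j \in seen s k then c * x j else 0.
  have := D2 y; rewrite -/y => /(_ _); rewrite -/y.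
  have -> : \sum_j (c * x j * D j) * (j \in seen s k)%:R = \sum_j y j * D j.
    by apply: eq_bigr => j _; rewrite /y; case: ifP; rewrite ?mulr1 ?mulr0 ?mul0r.
  apply=> j; rewrite /y; have /andP[xj0 xj1] := x01 j.
  by case: ifP => _; rewrite ?lexx ?mulr_ge0 //= ler_piMl.
rewrite big_split /= sumr_const card_perm_ord exchange_big /=.
under [X in _ <= _ + X]eq_bigr do rewrite -mulr_sumr sum_perm_seen.
set q := k.+1%:R / n%:R.
have q1 : q <= 1.
  by rewrite ler_pdivrMr ?mul1r ?ler_nat ?ltn_ord // ltr0n (leq_trans _ (ltn_ord k)).
have q0 : 0 <= q by rewrite divr_ge0 ?ler0n.
have -> : \sum_j c * x j * D j * (q * n`!%:R) = c * q * n`!%:R * (mlin f x - f set0).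
  rewrite D1 addrC addKr mulr_sumr; apply: eq_bigr => j _; ring.
rewrite -[f set0 *+ _]mulr_natr -subr_ge0.
have -> : f set0 * n`!%:R + c * q * n`!%:R * (mlin f x - f set0) - c * q * mlin f x * n`!%:R
  = f set0 * n`!%:R * (1 - c * q).
  move: (mlin f x) (f set0) (n`!%:R : K) => u v w; ring.
rewrite mulr_ge0 ?mulr_ge0 ?f0 ?ler0n // subr_ge0.
by apply: le_trans q1; rewrite ler_piMl.
Qed.

(** [a * k * (n - k)] is a subsolution of the recurrence that vanishes at [n]; backward induction
    compares it with [v]. *)
Lemma recurrence_bound (v : nat -> K) (a : K) :
  (forall k, (r0 <= k < n)%N ->
    k%:R / k.+1%:R * v k.+1 + k.+1%:R^-1 * (a * k.+1%:R ^+ 2) <= v k) ->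
  0 <= a -> 0 <= v n -> (r0 <= n)%N -> a * (r0%:R * (n - r0)%:R) <= v r0.
Proof.
move=> step a0 vn r0n.
suff H d k : (n - k)%N = d -> (r0 <= k <= n)%N -> a * (k%:R * d%:R) <= v k.
  by apply: H; rewrite ?leqnn.
elim: d k => [|d IH] k e kn.
  have -> : k = n by lia.
  by rewrite !mulr0.
have H : a * (k.+1%:R * d%:R) <= v k.+1 by apply: IH; lia.
apply: le_trans (step k _); last by lia.
have k1 : (k.+1%:R : K) != 0 by rewrite pnatr_eq0.
have -> : k.+1%:R^-1 * (a * k.+1%:R ^+ 2) = a * k.+1%:R.
  by rewrite expr2 mulrCA mulKf.
apply: (@le_trans _ _ (k%:R / k.+1%:R * (a * (k.+1%:R * d%:R)) + a * k.+1%:R)).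
  have -> : k%:R / k.+1%:R * (a * (k.+1%:R * d%:R)) = a * (k%:R * d%:R).
    by move: (k.+1%:R : K) k1 => u u0; field.
  by rewrite -(natr1 d) mulrDr mulr1 mulrDr lerD2l ler_wpM2l // ler_nat.
by rewrite lerD2r ler_wpM2l // divr_ge0 ?ler0n.
Qed.

Definition tgain (k : nat) s C : K := f (tent k s C) - f (tent k.+1 s C).

Lemma tgain_ge0 k s C : 0 <= tgain k s C.
Proof. by rewrite subr_ge0 fm // tentS. Qed.

(* Telescoping from the last round backwards: later accepted items form a
   subset of the later tentative items. *)
Lemma accepted_value s C P : P \subset C ->
  f set0 + \sum_(k in P) tgain k s C <= f (s @: P).
Proof.
move=> PC.
have tPC k : tent k s P \subset tent k s C.
  apply: imsetS; apply/subsetP => r; rewrite !inE => /andP[rP ->].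
  by rewrite (subsetP PC).
have -> : s @: P = tent 0 s P.
  have e : [set r in P | (0 <= r)%N] = P by apply/setP => r; rewrite inE andbT.
  by rewrite /tent e.
rewrite addrC -lerBrDr -(tent_all s P).
rewrite -(sum_ord_telescope (fun k => f (tent k s P)) (leq0n n)) big_mkcond.
apply: ler_sum => k _; have := tgain_ge0 k s P; rewrite /tgain.
case: ifP => // kP _; rewrite !tent_step kP (subsetP PC) //.
exact: marginal_le.
Qed.

Variables (I : finType) (supp : 'I_n -> {set I}) (z : I -> 'I_n -> K).
Variables (th mu D M : K) (d : nat).
Hypothesis th0 : 0 <= th.
Hypothesis z0 : forall i j, 0 <= z i j.
Hypothesis zmu : forall i s (l : 'I_n), (r0 <= l)%N ->
    l.+1%:R^-1 * \sum_(j in seen s l) xt l (seen s l) j * z i j <= mu.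
Hypothesis suppd : forall j, (#|supp j| <= d)%N.
Hypothesis D0 : 0 <= D.
Hypothesis M0 : 0 <= M.
Hypothesis muM : forall k, (k < n)%N -> (1 + th * mu) ^+ (k - r0) <= M.
Hypothesis half : d%:R * (D * M) <= 2%:R^-1.
Hypothesis r0n : (r0 <= n)%N.

(* With [th = exp t - 1] and [0 <= z <= 1] this dominates [exp (t * Z)], where [Z]
   is the total [z i] of the tentative items of rounds [r0 <= r < k]. *)
Definition load_moment i k s C : K :=
  \prod_(r < n | (r0 <= r < k)%N) (1 + th * ((r \in C)%:R * z i (s r))).

Lemma load_moment_ge0 i k s C : 0 <= load_moment i k s C.
Proof.
by apply: prodr_ge0 => r _; rewrite addr_ge0 // mulr_ge0 // mulr_ge0 // ler0n.
Qed.

(** A Markov bound in disguise: the gain of a rejected item is charged to a row whose scaled moment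
    is at least 1, and the expected charge is at most half of the expected gain. *)
Lemma accept_half (P : {perm 'I_n} -> {set 'I_n} -> {set 'I_n}) :
  (forall s C, P s C \subset C) ->
  (forall s C (k : 'I_n), k \in C -> (r0 <= k)%N -> k \notin P s C ->
     exists2 i, i \in supp (s k) & 1 <= D * load_moment i k s C) ->
  2%:R^-1 * EE r0 xt (fun s C => f (tent r0 s C)) <= EE r0 xt (fun s C => f (s @: P s C)).
Proof.
move=> PC bad.
pose g (k : 'I_n) s C := tgain k s C.
pose ind i j : K := (i \in supp j)%:R.
(* The charge of round [k], a union bound over the rows of its item; it is at least [tgain k] when a
   tentative item is rejected. *)
pose B (k : 'I_n) s C := \sum_i D * (tgain k s C * ind i (s k) * load_moment i k s C).
apply: (@le_trans _ _ (EE r0 xt (fun s C => f set0 +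
    \sum_(k < n | (r0 <= k)%N) (tgain k s C + -1 * B k s C)))); last first.
  apply: EE_le => // s C; apply: le_trans (accepted_value _ (PC s C)); rewrite lerD2l.
  rewrite [X in X <= _]big_mkcond [X in _ <= X]big_mkcond; apply: ler_sum => k _.
  have g0 := tgain_ge0 k s C.
  have B0 : 0 <= B k s C.
    by apply: sumr_ge0 => i _; rewrite !mulr_ge0 ?load_moment_ge0 ?ler0n.
  case: (boolP (k \in P s C)) => kP; case: (boolP (r0 <= k)%N) => r0k //.
    by rewrite mulN1r lerBlDr lerDl.
  have [kC|kC] := boolP (k \in C); last first.
    have t0 : tgain k s C = 0 by rewrite /tgain tent_step (negPf kC) subrr.
    by rewrite t0 add0r mulN1r oppr_le0.
  have [i ik Li] := bad s C k kC r0k kP.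
  rewrite mulN1r subr_le0 /B (bigD1 i) //= /ind ik mulr1 mulrCA.
  apply: (@le_trans _ _ (tgain k s C * (D * load_moment i k s C))); first by rewrite ler_peMr.
  rewrite lerDl; apply: sumr_ge0 => i' _.
  by rewrite !mulr_ge0 ?load_moment_ge0 ?ler0n.
rewrite EED EE_cst EE_sum.
have step (k : 'I_n) : (r0 <= k)%N -> 2%:R^-1 * EE r0 xt (tgain k) <=
    EE r0 xt (fun s C => tgain k s C + -1 * B k s C).
  move=> r0k; rewrite EED EEZ mulN1r lerBrDr -lerBrDl.
  apply: (@le_trans _ _ (2%:R^-1 * EE r0 xt (tgain k))); last by lra.
  have tE0 : 0 <= EE r0 xt (tgain k).
    by rewrite -(EE_cst r0 xt 0); apply: EE_le => // s C; apply: tgain_ge0.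
  apply: le_trans (ler_wpM2r tE0 half).
  rewrite /B EE_sum.
  apply: (@le_trans _ _ (\sum_i D * M * EE r0 xt (fun s C => tgain k s C * ind i (s k)))).
    apply: ler_sum => i _; rewrite EEZ -mulrA; apply: ler_wpM2l => //.
    have ti0 s C : 0 <= tgain k s C * ind i (s k).
      by rewrite mulr_ge0 ?tgain_ge0 ?ler0n.
    (* [tgain k] and the item [s k] are determined by rounds [>= k], so their product is an
       admissible weight. *)
    apply: le_trans (EE_mgf xt01 th0 (z0 i) (ltnW (ltn_ord k)) (zmu i) _ ti0) _.
      move=> s s' C C' ss' CC'; rewrite ss' //; congr (_ * _).
      rewrite /tgain (tent_future f ss' CC'); congr (_ - _).
      by apply: (tent_future f) => r kr; [apply: ss' | apply: CC']; apply: ltnW.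
    apply: ler_wpM2r; last exact: muM.
    by rewrite -(EE_cst r0 xt 0); apply: EE_le.
  rewrite -mulr_sumr -EE_sum [d%:R * _]mulrC -[_ * d%:R * _]mulrA.
  apply: ler_wpM2l; first exact: mulr_ge0.
  rewrite -EEZ; apply: EE_le => // s C; rewrite -mulr_sumr mulrC.
  apply: ler_wpM2r; first exact: tgain_ge0.
  rewrite -natr_sum ler_nat (leq_trans _ (suppd (s k))) //.
  by rewrite -sum1_card [X in (_ <= X)%N]big_mkcond.
have tot : \sum_(k < n | (r0 <= k)%N) EE r0 xt (tgain k) =
    EE r0 xt (fun s C => f (tent r0 s C)) - f set0.
  rewrite -EE_sum -(EE_cst r0 xt (f set0)) -mulN1r -EEZ -EED; apply: eq_EE => s C.
  rewrite /tgain (sum_ord_telescope (fun k => f (tent k s C)) r0n).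
  by rewrite tent_all mulN1r.
(* The telescoped sum misses [f set0], which is present in full and is needed only by half. *)
apply: (@le_trans _ _ (f set0 + 2%:R^-1 * \sum_(k < n | (r0 <= k)%N) EE r0 xt (tgain k))).
  by rewrite tot; have := f0 set0; lra.
rewrite lerD2l mulr_sumr; apply: ler_sum => k r0k; exact: step.
Qed.

End Analysis.

(** * The algorithm *)

Section Algorithm.
Variables (n m : nat) (A : 'I_m -> 'I_n -> R) (b : 'I_m -> R) (p : R).
Implicit Types (s : {perm 'I_n}) (C Y : {set 'I_n}) (c : {ffun 'I_n -> bool}).
Hypothesis b0 : forall i, 0 < b i.

Lemma int_feasibleP Y : reflect (int_feasible A b Y) (int_feasibleb A b Y).
Proof.
apply: (iffP forallP) => h i; have := h i; rewrite /Defs.Rleb; by case: Rle_dec.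
Qed.

Lemma int_feasibleE Y : int_feasible A b Y <-> forall i, \sum_(j in Y) A i j <= b i.
Proof. by split=> h i; apply/RleP; apply: h. Qed.

Lemma run_feasible s c k : int_feasible A b (run A b p s c k).
Proof.
elim: k => [|k IH] /=.
  by apply/int_feasibleE => i; rewrite big_set0 ltW.
case: insub => // r; rewrite /step; case: ifP => // /andP[_].
by move/int_feasibleP.
Qed.

Definition coins C : {ffun 'I_n -> bool} := [ffun r => r \in C].

(** A set of rounds rather than items, so that it can be compared with [C]. *)
Definition accepted s C : {set 'I_n} :=
  [set r | [&& active p r, r \in C & int_feasibleb A b (s r |: run A b p s (coins C) r)]].

Lemma run_accepted s C k :
  run A b p s (coins C) k = s @: [set r in accepted s C | (r < k)%N].
Proof.
elim: k => [|k IH] /=.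
  rewrite (_ : [set _ in _ | _] = set0) ?imset0 //.
  by apply/setP => r; rewrite inE andbF in_set0.
have [kn|nk] := ltnP k n; last first.
  have e : [set r in accepted s C | (r < k)%N] = [set r in accepted s C | (r < k.+1)%N].
    apply/setP => r; rewrite inE [RHS]inE; congr (_ && _).
    by have := ltn_ord r; lia.
  by rewrite insubF ?ltnNge ?nk //= IH e.
rewrite (insubT (fun k => k < n)%N kn) /=; set r0 := Ordinal kn.
have E (Q : {set 'I_n}) : [set r in Q | (r < k.+1)%N] =
    if r0 \in Q then r0 |: [set r in Q | (r < k)%N] else [set r in Q | (r < k)%N].
  apply/setP => r; have kr : (r < k.+1)%N = (r == r0) || (r < k)%N.
    by rewrite ltnS leq_eqVlt -val_eqE.
  by case: ifP => k0; rewrite !inE kr; case: eqVneq => [->|]; rewrite ?k0 ?andbF.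
rewrite E /step {1}/accepted inE ffunE -andbA.
by case: ifP => // _; rewrite IH imsetU1.
Qed.

Lemma output_accepted s C : output A b p s (coins C) = s @: accepted s C.
Proof.
have e : [set r in accepted s C | (r < n)%N] = accepted s C.
  by apply/setP => r; rewrite inE ltn_ord andbT.
by rewrite /output run_accepted e.
Qed.

Lemma expected_valueE (f : {set 'I_n} -> R) O r0 :
  (forall r : 'I_n, active p r = (r0 <= r)%N) ->
  expected_value A b f O p =
  EE r0 (fun r : 'I_n => O r.+1) (fun s C => f (s @: accepted s C)).
Proof.
move=> act; rewrite /expected_value RdivE INRE; congr (_ / _).
apply: eq_bigr => s _; rewrite /mlin.
rewrite (reindex (fun c : {ffun 'I_n -> bool} => [set r | c r])) /=; last first.
  exists coins => [c _|C _]; first by apply/ffunP => r; rewrite ffunE inE.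
  by apply/setP => r; rewrite inE ffunE.
apply: eq_bigr => c _.
have cE : coins [set r | c r] = c by apply/ffunP => r; rewrite ffunE inE.
rewrite -output_accepted cE.
have -> : multilinear f (indicator (output A b p s c)) = f (output A b p s c).
  exact: mlin_indicator.
rewrite RmultE mulrC; congr (_ * _); apply: eq_bigr => r _.
by rewrite inE /coin_prob /coin act.
Qed.

End Algorithm.

(** * Oracle guarantee against admissible points *)

Section Oracle.
Variables (n m : nat) (A : 'I_m -> 'I_n -> R) (b : 'I_m -> R) (f : {set 'I_n} -> R).
Hypothesis fm : monotone f.

Lemma in_PE (t : R) (S : {set 'I_n}) x : in_P A b t S x <->
  [/\ forall j, 0 <= x j <= 1, forall i, \sum_j A i j * x j <= t * b i
    & forall j, j \notin S -> x j = 0].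
Proof.
split=> [[x01 [xb xS]]|[x01 xb xS]]; split=> //.
- by move=> j; have [/RleP -> /RleP ->] := x01 j.
- by move=> i; apply/RleP.
- by move=> j; have /andP[/RleP ? /RleP ?] := x01 j.
- by split=> // i; apply/RleP.
Qed.

(** The oracle is specified against a supremum, which exists by completeness because [f setT] bounds
    [mlin f]. *)
Lemma oracle_le (alpha : R) O (l : nat) (S : {set 'I_n}) y :
  oracle_spec A b f alpha O -> (1 <= l <= n)%N -> 0 <= alpha ->
  in_P A b (INR l / INR n) S y -> alpha * mlin f y <= mlin f (O l S).
Proof.
move=> spec ln a0 Py; have [_ H] := spec l S ln.
pose E w := exists x, in_P A b (INR l / INR n) S x /\ w = multilinear f x.
have bE : bound E.
  exists (f setT) => w [x [/in_PE[x01 _ _] ->]]; apply/RleP.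
  rewrite -[X in _ <= X](mlin_cst _ x); apply: mlin_le => // T.
  exact/RleP/fm/subsetT.
have [v lv] := completeness E bE (ex_intro _ _ (ex_intro _ y (conj Py erefl))).
apply: (@le_trans _ _ (alpha * v)); last by apply/RleP; exact: H.
by apply: ler_wpM2l => //; apply/RleP; apply: lv.1; exists y.
Qed.

End Oracle.

Lemma exp_sum_le (I : finType) (P : pred I) (t : R) (z : I -> R) :
  (forall i, P i -> 0 <= z i <= 1) ->
  exp (t * \sum_(i | P i) z i) <= \prod_(i | P i) (1 + (exp t - 1) * z i).
Proof.
move=> z01; rewrite RmultE mulr_sumr.
elim/big_rec2: _ => [|i y x Pi le]; first by rewrite exp_0.
rewrite -expRD; apply: ler_pM => //; try by apply/RleP; left; apply: exp_pos.
by apply/RleP/exp_chord; have /andP[/RleP ? /RleP ?] := z01 i Pi.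
Qed.

Lemma exp_ge0 (x : R) : 0 <= exp x.
Proof. by apply/RleP; left; apply: exp_pos. Qed.

Lemma exp_sub1_ge0 (x : R) : 0 <= x -> 0 <= exp x - 1.
Proof.
move=> x0; rewrite subr_ge0; apply: (@le_trans _ _ (1 + x)); first by rewrite lerDl.
by apply/RleP; exact: exp_ineq1_le.
Qed.

(** * Rejections and overloaded rows *)

Section Competitive.
Variables (n m : nat) (B : R) (A : 'I_m -> 'I_n -> R) (b : 'I_m -> R).
Hypothesis A0 : forall i j, 0 <= A i j.
Hypothesis b0 : forall i, 0 < b i.
Hypothesis AB : forall i j, A i j * B <= b i.
Hypothesis B2 : 2%:R <= B.
Variables (p : R) (r0 : nat).
Hypothesis act : forall r : 'I_n, active p r = (r0 <= r)%N.
Variable t : R.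
Hypothesis t0 : 0 <= t.

(* The load of item [j] on row [i], in units of [b i / B], the largest possible
   entry of the row. *)
Definition usage i j := A i j * B / b i.
Definition loaded_rows j : {set 'I_m} := [set i | ~~ isz (A i j)].

Lemma usage01 i j : 0 <= usage i j <= 1.
Proof.
have B0 : 0 <= B by apply: le_trans B2.
rewrite /usage ler_pdivrMr // mul1r AB andbT.
by apply: divr_ge0; [apply: mulr_ge0 | apply: ltW].
Qed.

(** The rejected item overflows some row [i] but takes at most one unit of [b i / B], so the earlier
    accepted items take at least [B - 1] units. It does use row [i], because the earlier items alone
    fit. *)
Lemma rejected_overload (s : {perm 'I_n}) (C : {set 'I_n}) (k : 'I_n) :
  k \in C -> (r0 <= k)%N -> k \notin accepted A b p s C ->
  exists2 i, i \in loaded_rows (s k) &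
    1 <= exp (- (t * (B - 1)))%R * load_moment r0 usage (exp t - 1) i k s C.
Proof.
move=> kC r0k; rewrite inE act r0k kC /= => /forallPn[i].
rewrite /Defs.Rleb; case: Rle_dec => // nle _.
set Y := run A b p s (coins C) k in nle.
have {nle} over : b i < \sum_(j in s k |: Y) A i j.
  by rewrite ltNge; apply/negP => /RleP.
have Yle : \sum_(j in Y) A i j <= b i.
  by apply/RleP; exact: (run_feasible A p b0 s (coins C) k i).
pose Q := [set r in accepted A b p s C | (r < k)%N].
have YQ : Y = s @: Q by rewrite /Y run_accepted.
have skY : s k \notin Y by rewrite YQ mem_imset ?inE ?ltnn ?andbF //; exact: perm_inj.
rewrite big_setU1 //= in over.
exists i.
  rewrite inE /isz; case: RIneq.Req_EM_T => //= e; exfalso.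
  by move: over; rewrite (e : A i (s k) = 0) add0r ltNge Yle.
have B0 : 0 < B by apply: lt_le_trans B2; rewrite ltr0n.
have heavy : B - 1 <= \sum_(r in Q) usage i (s r).
  have -> : \sum_(r in Q) usage i (s r) = (\sum_(j in Y) A i j) * B / b i.
    rewrite YQ big_imset /=; last by move=> x y _ _; apply: perm_inj.
    by rewrite !mulr_suml.
  rewrite ler_pdivlMr //; have := AB i (s k); have := b0 i; nra.
have c0 : 0 <= exp (- (t * (B - 1)))%R by apply: exp_ge0.
apply: (@le_trans _ _ (exp (- (t * (B - 1)))%R * exp (t * \sum_(r in Q) usage i (s r))%R)).
  rewrite expRD -[X in X <= _]exp_0; apply/RleP.
  have : 0 <= - (t * (B - 1)) + t * \sum_(r in Q) usage i (s r).
    by rewrite addrC subr_ge0 ler_wpM2l.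
  move=> /RleP [h|h]; first by left; apply: exp_increasing.
  by right; congr exp.
apply: ler_wpM2l => //.
apply: le_trans (exp_sum_le t (fun r _ => usage01 i (s r))) _.
(* Accepted rounds before [k] all occur in the product, and its remaining factors are at least 1. *)
rewrite /load_moment big_mkcond [X in _ <= X]big_mkcond; apply: ler_prod => r _.
have th0 := exp_sub1_ge0 t0.
have /andP[u0 _] := usage01 i (s r).
have x1 : 0 <= (exp t - 1) * usage i (s r) by rewrite mulr_ge0.
rewrite !inE act -andbA.
case: (leqP r0 r) => //= r0r; last by rewrite ler01 lexx.
case: (r \in C); case: (ltnP r k) => //= _;
  rewrite ?andbF ?andbT ?mul1r ?mul0r ?mulr0 ?addr0 ?ler01 ?lexx //.
by case: ifP => _; rewrite ?ler01 ?lexx ?addr_ge0 //= ?lerDl.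
Qed.

End Competitive.

(** * Parameters of the algorithm and the final estimate *)

Section Assembly.
Variables (d n m : nat) (B : R) (A : 'I_m -> 'I_n -> R) (b : 'I_m -> R).
Variables (f : {set 'I_n} -> R) (alpha : R) (O : nat -> {set 'I_n} -> 'I_n -> R).
Hypothesis n4 : (4 <= n)%N.
Hypothesis A0 : forall i j, 0 <= A i j.
Hypothesis b0 : forall i, 0 < b i.
Hypothesis dA : col_sparsity A = d.
Hypothesis d1 : (1 <= d)%N.
Hypothesis AB : forall i j, A i j * B <= b i.
Hypothesis B2 : 2%:R <= B.
Hypothesis f0 : forall S, 0 <= f S.
Hypothesis fmon : monotone f.
Hypothesis fsub : submodular f.
Hypothesis alpha0 : 0 <= alpha.
Hypothesis spec : oracle_spec A b f alpha O.

Let dl := delta (INR d) B.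
Let p := p_sample d B.
(** The first active round, counted from 0: [p * n < r + 1] exactly when [r0 <= r]. *)
Let r0 := Num.truncn (p * n%:R).
Let xt (r : 'I_n) := O r.+1.
Let t := lam (INR d) B.

Let two : (2%:R : R) = IZR 2. Proof. by rewrite -INRE. Qed.

Let fm (S S' : {set 'I_n}) : S \subset S' -> f S <= f S'.
Proof. by move=> SS'; apply/RleP/fmon. Qed.

Let fs (S S' : {set 'I_n}) : f (S :|: S') + f (S :&: S') <= f S + f S'.
Proof. by apply/RleP/fsub. Qed.

Let d1R : Rle (IZR 1) (INR d).
Proof. by apply/RleP; rewrite INRE ler1n. Qed.

Let B2R : Rle (IZR 2) B.
Proof. by apply/RleP; rewrite -two. Qed.

Let dl0 : 0 < dl. Proof. by apply/RltP; have [] := delta_bounds d1R B2R. Qed.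

Let dl4 : dl * 4%:R <= 1.
Proof.
have [_ /RleP] := delta_bounds d1R B2R; rewrite -/dl.
have -> : Rinv (IZR 4) = (4%:R)^-1 by rewrite RinvE; congr (_^-1); rewrite -INRE INR_IZR_INZ.
by rewrite -[X in _ <= X]mul1r ler_pdivlMr // ltr0n.
Qed.

Let pE : p = 1 - dl. Proof. by []. Qed.

Let n0 : 0 < (n%:R : R). Proof. by rewrite ltr0n; lia. Qed.

Let r0_itv : r0%:R <= p * n%:R < r0.+1%:R.
Proof.
by apply: truncn_itv; apply: mulr_ge0; [rewrite pE; have := dl4; lra | apply: ltW].
Qed.

Let r0n : (r0 < n)%N.
Proof.
have /andP[h _] := r0_itv; rewrite -(ltr_nat R); apply: le_lt_trans h _.
by rewrite pE mulrBl mul1r gtrBl mulr_gt0.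
Qed.

Let act (r : 'I_n) : active p r = (r0 <= r)%N.
Proof.
have /andP[h1 h2] := r0_itv; rewrite /active /Defs.Rltb.
case: Rlt_dec => h0 /=; symmetry.
  by move/RltP: h0; rewrite !INRE RmultE => h; have := le_lt_trans h1 h; rewrite ltr_nat.
apply/negbTE; rewrite -ltnNge; move/RltP: h0; rewrite !INRE RmultE -leNgt => h.
by have := le_lt_trans h h2; rewrite ltr_nat.
Qed.

Let lP (r : 'I_n) : (1 <= r.+1 <= n)%N. Proof. by rewrite ltn_ord. Qed.

Let xtP (r : 'I_n) S :
  [/\ forall j, 0 <= xt r S j <= 1,
      forall i, \sum_j A i j * xt r S j <= r.+1%:R / n%:R * b i
    & forall j, j \notin S -> xt r S j = 0].
Proof.
by have [/in_PE] := spec S (lP r); rewrite RdivE !INRE.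
Qed.

Let xt01 k S j : 0 <= xt k S j <= 1. Proof. by have [] := xtP k S. Qed.
Let xtS k (S : {set 'I_n}) j : j \notin S -> xt k S j = 0.
Proof. by have [_ _] := xtP k S; apply. Qed.

(** The oracle point fills at most the fraction [l.+1 / n] of row [i]; averaging over [l.+1] seen
    items cancels [l.+1]. *)
Let usage_mean i (s : {perm 'I_n}) (l : 'I_n) : (r0 <= l)%N ->
  l.+1%:R^-1 * \sum_(j in seen s l) xt l (seen s l) j * usage B A b i j <= B / n%:R.
Proof.
move=> _; have [x01 xb _] := xtP l (seen s l).
have B0 : 0 <= B by apply: le_trans B2.
have l0 : 0 < (l.+1%:R : R) by rewrite ltr0n.
apply: (@le_trans _ _ (l.+1%:R^-1 * (B / b i * \sum_j A i j * xt l (seen s l) j))).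
  rewrite ler_pM2l ?invr_gt0 // mulr_sumr big_mkcond; apply: ler_sum => j _.
  have /andP[x0 _] := x01 j.
  have c0 : 0 <= B / b i by rewrite divr_ge0 // ltW.
  case: ifP => _; last by apply: mulr_ge0 => //; apply: mulr_ge0.
  by rewrite /usage le_eqVlt; apply/orP; left; apply/eqP; ring.
rewrite mulrC ler_pdivrMr //.
have -> : B / n%:R * l.+1%:R = B / b i * (l.+1%:R / n%:R * b i).
  by field; rewrite !gt_eqF.
by rewrite ler_wpM2l // divr_ge0 // ltW.
Qed.

Let growth k : (k < n)%N -> (1 + (exp t - 1) * (B / n%:R)) ^+ (k - r0) <= exp (B - 1)%R.
Proof.
move=> kn; rewrite -INRE -RdivE -RpowE; apply/RleP.
apply: mgf_power_bound => //; first by apply/ssrnat.ltP; lia.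
apply/RleP; rewrite -/dl RmultE !INRE.
have /andP[_ h] := r0_itv.
(* The strict [k < n] pays for the rounding in [p * n < r0 + 1]. *)
apply: (@le_trans _ _ ((n - r0.+1)%:R)); first by rewrite ler_nat; lia.
by rewrite natrB //; rewrite pE in h; lra.
Qed.

Lemma half_tentative :
  2%:R^-1 * EE r0 xt (fun s C => f (tent r0 s C)) <= expected_value A b f O p.
Proof.
rewrite (expected_valueE A b f O act).
apply: (@accept_half _ _ _ _ xt01 f fm fs f0 'I_m (loaded_rows A) (usage B A b)
  (exp t - 1) (B / n%:R) (exp (- (t * (B - 1)))%R) (exp (B - 1)%R) d) => //.
- by apply/exp_sub1_ge0/RleP/lam_ge0.
- by move=> i j; have /andP[] := usage01 A0 b0 AB B2 i j.
- by move=> j; rewrite -dA /col_sparsity (leq_bigmax j).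
- exact: exp_ge0.
- exact: exp_ge0.
- by rewrite -INRE two; apply/RleP; right; exact: union_bound_constant.
- exact: ltnW.
- by move=> s C; apply/subsetP => k; rewrite inE => /and3P[].
- move=> s C k kC r0k kP; apply: rejected_overload => //.
  by apply/RleP/lam_ge0.
Qed.

Lemma tentative_value x : in_P A b 1 setT x ->
  alpha * mlin f x / n%:R ^+ 2 * (r0%:R * (n - r0)%:R) <=
  EE r0 xt (fun s C => f (tent r0 s C)).
Proof.
move=> /in_PE [x01 xb _].
apply: (@recurrence_bound _ n r0 (fun k => EE r0 xt (fun s C => f (tent k s C)))).
- move=> k /andP[r0k kn]; pose ko := Ordinal kn.
  apply: le_trans (tent_value_step xt01 fm fs xtS (k := ko) r0k).
  rewrite lerD2l; apply: ler_wpM2l; first by rewrite invr_ge0 ler0n.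
  (* [c] enters twice: as the scaling that makes the point admissible and as the probability of
     being seen. *)
  pose c := (k.+1%:R : R) / n%:R.
  have c01 : 0 <= c <= 1.
    by rewrite /c divr_ge0 ?ler0n //= ler_pdivrMr // mul1r ler_nat.
  have -> : alpha * mlin f x / n%:R ^+ 2 * k.+1%:R ^+ 2 =
      alpha * (c * (ko.+1%:R / n%:R) * mlin f x).
    by rewrite /c /=; field; rewrite gt_eqF.
  apply: le_trans (ler_wpM2l alpha0 (mlin_sampled fm fs f0 ko c01 x01)) _.
  rewrite EE_perm mulrA; apply: ler_wpM2r; first by rewrite invr_ge0 ler0n.
  rewrite mulr_sumr; apply: ler_sum => s _; apply: (oracle_le fmon spec (lP ko)) => //.
  apply/in_PE; rewrite RdivE !INRE /=; have /andP[c0 c1] := c01; split=> [j|i|j].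
  - have /andP[x0 x1] := x01 j; case: ifP => _; last by rewrite lexx ler01.
    by rewrite mulr_ge0 //= mulr_ile1.
  - apply: le_trans (_ : c * (\sum_j A i j * x j) <= _).
      rewrite mulr_sumr; apply: ler_sum => j _; rewrite mulrCA; apply: ler_wpM2l => //.
      have /andP[x0 x1] := x01 j; case: ifP => _ //.
      exact: mulr_ge0.
    by apply: ler_wpM2l => //; have := xb i; rewrite mul1r.
  - by move=> /negPf ->.
- apply: divr_ge0; last by rewrite exprn_ge0 // ltW.
  by apply: mulr_ge0 => //; rewrite -(mlin_cst 0 x); apply: mlin_le.
- by rewrite -(EE_cst r0 xt 0); apply: EE_le.
- exact: ltnW.
Qed.

Lemma feasible_point_bound x : in_P A b 1 setT x ->
  alpha * (dl / 4%:R) * mlin f x <= expected_value A b f O p.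
Proof.
move=> Px; apply: le_trans half_tentative.
have x01 : forall j, 0 <= x j <= 1 by have /in_PE[] := Px.
have F0 : 0 <= alpha * mlin f x.
  by apply: mulr_ge0 => //; rewrite -(mlin_cst 0 x); apply: mlin_le.
have h2 : 0 <= (2%:R : R)^-1 by rewrite invr_ge0 ler0n.
apply: le_trans (ler_wpM2l h2 (tentative_value Px)).
have /andP[l1 l2] := r0_itv.
have n4R : 4%:R <= (n%:R : R) by rewrite ler_nat.
(* From [dl <= 1/4] and [n >= 4]: [r0 > 3 * n / 4 - 1 >= n / 2]. *)
have hr : n%:R / 2%:R <= (r0%:R : R).
  move: l2; rewrite -natr1 pE; have := dl4; nra.
have hn : dl * n%:R <= (n - r0)%:R.
  by rewrite natrB ?(ltnW r0n) //; move: l1; rewrite pE; lra.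
have key : (n%:R / 2%:R) * (dl * n%:R) <= r0%:R * (n - r0)%:R.
  by apply: ler_pM => //; [rewrite divr_ge0 // ltW | rewrite mulr_ge0 // ltW].
(* The 4 combines the accepted half with the factor lost in [r0 >= n / 2]. *)
have -> : alpha * (dl / 4%:R) * mlin f x =
    2%:R^-1 * (alpha * mlin f x / n%:R ^+ 2 * ((n%:R / 2%:R) * (dl * n%:R))).
  by field; rewrite gt_eqF.
apply: ler_wpM2l => //; apply: ler_wpM2l => //.
by rewrite divr_ge0 // exprn_ge0 // ltW.
Qed.

End Assembly.

(** * Competitiveness of the modified algorithm *)

Local Open Scope R_scope.

Theorem mainTheorem15 :
  exists c0 : R, 0 < c0 /\
  forall eps : R, 0 < eps ->
  forall (d : nat) (B : R), exists N : nat,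
  forall (n m : nat) (A : 'I_m -> 'I_n -> R) (b : 'I_m -> R)
    (f : {set 'I_n} -> R) (alpha : R) (O : nat -> {set 'I_n} -> 'I_n -> R)
    (Fstar : R),
    (N <= n)%N ->
    (forall i j, 0 <= A i j) -> (forall i j, A i j <= 1) -> (forall i, 0 < b i) ->
    col_sparsity A = d -> is_capacity_ratio A b B -> 2 <= B ->
    (forall T, 0 <= f T) -> monotone f -> submodular f ->
    0 < alpha <= 1 -> oracle_spec A b f alpha O ->
    is_Fstar A b f Fstar ->
    (forall (sigma : {perm 'I_n}) (c : {ffun 'I_n -> bool}),
        int_feasible A b (output A b (p_sample d B) sigma c)) /\
    (c0 * alpha * Rpower (INR d) (- / (B - 1)) - eps) * Fstar
      <= expected_value A b f O (p_sample d B).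
Proof.
(* The product of [/ 4] from [feasible_point_bound] and [/ (4 * exp 1)] from [delta_lower]. *)
exists (/ (16 * exp 1)); split.
  by apply: Rinv_0_lt_compat; apply: Rmult_lt_0_compat; [apply: (IZR_lt 0 16) | apply: exp_pos].
move=> eps eps0 d B; exists 4%N.
move=> n m A b f alpha O Fstar n4 A0 _ b0 dA [AB [i [j [Aij _]]]] B2
  f0 fm fs [alpha0 _] spec [ub lub].
split=> [sigma c|].
  by apply: run_feasible => k; apply/RltP.
(* The row and column attaining the capacity ratio provide a nonzero entry. *)
have d1 : (1 <= d)%N.
  rewrite -dA; apply: leq_trans (leq_bigmax j).
  rewrite /col_nnz card_gt0; apply/set0Pn; exists i; rewrite inE /isz.
  by case: RIneq.Req_EM_T => //= e; case: (Rlt_irrefl 0); rewrite -{2}e.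
have d1R : 1 <= INR d by apply: (le_INR 1); apply/ssrnat.leP.
set E := expected_value A b f O (p_sample d B).
have bound x : in_P A b 1 setT x ->
    alpha * (delta (INR d) B / 4) * multilinear f x <= E.
  move=> Px; apply/RleP.
  have four : IZR 4 = GRing.natmul (GRing.one _) 4 by rewrite -INRE INR_IZR_INZ.
  rewrite RdivE four.
  apply: (@feasible_point_bound d n m B A b f alpha O n4 _ _ dA d1 _ _ _ fm fs _ spec x Px).
  - by move=> ? ?; apply/RleP.
  - by move=> ?; apply/RltP.
  - by move=> ? ?; apply/RleP.
  - by rewrite -INRE INR_IZR_INZ; apply/RleP.
  - by move=> ?; apply/RleP.
  - by apply/RleP; left.
have c0 : 0 < alpha * (delta (INR d) B / 4).
  have [dl0 _] := delta_bounds d1R B2.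
  by apply: Rmult_lt_0_compat => //; apply: Rdiv_lt_0_compat => //; apply: (IZR_lt 0 4).
have F0 : 0 <= Fstar.
  apply: Rle_trans (f0 set0) _; rewrite -(mlin0 f); apply: ub; exists (fun=> 0); split=> //.
  split; [|split] => //; first by move=> ?; split; [apply: Rle_refl | apply: Rle_0_1].
  by move=> k; rewrite big1 => [|l _]; rewrite ?Rmult_0_r // Rmult_1_l; left.
apply: competitive_ratio_le => //.
(* Dividing by [c > 0] makes [E / c] an upper bound of all feasible values, hence of their supremum
   [Fstar]. *)
set c := alpha * _ in c0 bound *.
have cE : c * (E / c) = E.
  by rewrite /Rdiv Rmult_comm Rmult_assoc Rinv_l ?Rmult_1_r //; apply: Rgt_not_eq.
rewrite -cE; apply: Rmult_le_compat_l; first exact: Rlt_le.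
apply: lub => w [x [Px ->]]; apply: (Rmult_le_reg_l _ _ _ c0).
by rewrite cE; exact: bound.
Qed.
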